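(* Let $H_k \in \mathbb{R}^{n\times n}$ be symmetric positive definite and let $s_k, y_k\in\mathbb{R}^n$ satisfy $s_k^T y_k > 0$. For $\alpha_k>0$ define $$ \gamma_k = 0.5 + \sqrt{0.25 + \alpha_k\, y_k^TH_ky_k + \alpha_k^2 (s_k^Ty_k)^2}. $$ Then, as $\alpha_k \to \infty$ (with $H_k, s_k, y_k$ fixed), the matrix $$ H_k + \alpha_k s_k s_k^T - \frac{\alpha_k}{\gamma_k^2}\bigl(H_ky_k + \alpha_k (s_k^Ty_k)s_k\bigr)\bigl(H_ky_k + \alpha_k (s_k^Ty_k)s_k\bigr)^T $$ converges to $$ \left(I - \frac{s_ky_k^T}{s_k^Ty_k}\right)H_k\left(I - \frac{y_k s_k^T}{s_k^Ty_k}\right) + \frac{s_ks_k^T}{s_k^Ty_k}. $$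
   Context: $I$ denotes the $n\times n$ identity matrix. The first displayed matrix is the soft QN update of the Hessian inverse approximation $H_k$ with penalty parameter $\alpha_k$; the limit is the BFGS update. *)

(* Defs.v *)
From HB Require Import structures.
From mathcomp Require Import all_boot all_order all_algebra.
From mathcomp Require Import all_classical all_reals all_analysis.

Set Implicit Arguments.
Unset Strict Implicit.
Unset Printing Implicit Defensive.

Import Order.TTheory GRing.Theory Num.Theory.
Import numFieldNormedType.Exports.

Local Open Scope ring_scope.

Section SoftQN.
Context {R : realType} {n : nat}.
Implicit Types (H : 'M[R]_n) (s y u v : 'cV[R]_n) (alpha : R).

Definition dotv u v : R := (u^T *m v) 0 0.

Definition posdefmx H : Prop :=
  forall x : 'cV[R]_n, x != 0 -> 0 < dotv x (H *m x).

Definition softQN_gamma H s y alpha : R :=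
  2^-1 + Num.sqrt (4^-1 + alpha * dotv y (H *m y) + alpha ^+ 2 * dotv s y ^+ 2).

Definition softQN_update H s y alpha : 'M[R]_n :=
  let w := H *m y + (alpha * dotv s y) *: s in
  H + alpha *: (s *m s^T)
    - (alpha / softQN_gamma H s y alpha ^+ 2) *: (w *m w^T).

Definition BFGS_update H s y : 'M[R]_n :=
  let rho := (dotv s y)^-1 in
  (1%:M - rho *: (s *m y^T)) *m H *m (1%:M - rho *: (y *m s^T))
    + rho *: (s *m s^T).

End SoftQN.

(* Main.v *)
Require Import Defs.
From HB Require Import structures.
From mathcomp Require Import all_boot all_order all_algebra.
From mathcomp Require Import all_classical all_reals all_analysis.
From mathcomp Require Import ring.

Import Order.TTheory GRing.Theory Num.Theory.
Import numFieldNormedType.Exports.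

Local Open Scope classical_set_scope.
Local Open Scope ring_scope.

(** With [v = H y], [b = y^T H y] and [c = s^T y], the number [gamma] is the
    positive root of [gamma ^ 2 = gamma + alpha b + alpha ^ 2 c ^ 2].  This
    relation turns the coefficient [alpha - alpha ^ 3 c ^ 2 / gamma ^ 2] of
    [s s^T] in the soft update into [t + b t ^ 2] with [t = alpha / gamma], so
    that both the soft update and the BFGS update are members of one polynomial
    family in [(t, u)], at [(alpha / gamma, 1 / alpha)] and [(1 / c, 0)].  As
    [gamma / alpha] tends to [c], continuity of the family concludes. *)

Definition qn_family {R : realType} {n : nat} (H : 'M[R]_n) (s y : 'cV[R]_n)
    (t u : R) : 'M[R]_n :=
  let v := H *m y in
  H + (t + dotv y v * t ^+ 2) *: (s *m s^T)
    - (dotv s y * t ^+ 2) *: (s *m v^T + v *m s^T)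
    - (t ^+ 2 * u) *: (v *m v^T).

Lemma dotvC {R : realType} {n : nat} (u v : 'cV[R]_n) : dotv u v = dotv v u.
Proof. by rewrite /dotv !mxE; apply: eq_bigr => i _; rewrite !mxE mulrC. Qed.

Lemma mulmx_dotv {R : realType} {n : nat} (u v : 'cV[R]_n) :
  u^T *m v = (dotv u v)%:M.
Proof. exact: mx11_scalar. Qed.

Lemma posdefmx_ge0 {R : realType} {n : nat} (H : 'M[R]_n) (x : 'cV[R]_n) :
  posdefmx H -> 0 <= dotv x (H *m x).
Proof.
move=> Hpos; have [->|/Hpos/ltW//] := eqVneq x 0.
by rewrite /dotv mulmx0 mulmx0 mxE.
Qed.

Lemma softQN_gamma_gt0 {R : realType} {n : nat} (H : 'M[R]_n)
    (s y : 'cV[R]_n) (alpha : R) : 0 < softQN_gamma H s y alpha.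
Proof. by apply: ltr_wpDr; rewrite ?sqrtr_ge0 ?invr_gt0 ?ltr0n. Qed.

Lemma softQN_gamma_sqr {R : realType} {n : nat} {H : 'M[R]_n}
    (s : 'cV[R]_n) {y : 'cV[R]_n} {alpha : R} :
  0 <= alpha -> 0 <= dotv y (H *m y) ->
  softQN_gamma H s y alpha ^+ 2 =
  softQN_gamma H s y alpha + alpha * dotv y (H *m y)
    + alpha ^+ 2 * dotv s y ^+ 2.
Proof.
move=> a0 b0; rewrite /softQN_gamma; set r := (X in Num.sqrt X).
(* [Num.sqrt] is 0 on negative reals, so squaring gives back [r] only once [r] is known to be
   nonnegative. *)
have r0 : 0 <= r.
  by rewrite addr_ge0 ?addr_ge0 ?invr_ge0 ?ler0n// mulr_ge0 ?sqr_ge0.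
have := sqr_sqrtr r0; move: (Num.sqrt r) => q; rewrite /r => q2.
by rewrite sqrrD q2; field.
Qed.

(** With [t = alpha / gamma], the coefficient [alpha / gamma ^ 2] of [v v^T] is [t ^ 2 / alpha]; the
    cross terms carry a further factor [alpha c], which gives [c t ^ 2]. *)
Lemma softQN_update_family {R : realType} {n : nat} (H : 'M[R]_n)
    (s y : 'cV[R]_n) (alpha : R) :
  0 < alpha -> 0 <= dotv y (H *m y) ->
  softQN_update H s y alpha =
  qn_family H s y (alpha / softQN_gamma H s y alpha) alpha^-1.
Proof.
move=> a0 b0; have g2 := softQN_gamma_sqr s (ltW a0) b0.
have g0 := softQN_gamma_gt0 H s y alpha.
rewrite /softQN_update /qn_family /=; move: g2 g0.
move: (softQN_gamma _ _ _ _) (dotv s y) => g c.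
move: (dotv y _) => b; move: (H *m y) => v g2 g0.
apply/matrixP => i j; rewrite !mxE !big_ord1 !mxE.
(* Solving the relation for [b], not for [g], leaves a rational identity in otherwise free
   variables. *)
have {}g2 : b = (g ^+ 2 - g - alpha ^+ 2 * c ^+ 2) / alpha.
  by rewrite g2; field; rewrite gt_eqF.
by rewrite g2; field; rewrite !gt_eqF.
Qed.

(** In the expanded product the cross terms have coefficient [1 / c = c t ^ 2] at [t = 1 / c], the
    quadratic term gives [b t ^ 2], and no [v v^T] appears, whence [u = 0]. *)
Lemma BFGS_update_family {R : realType} {n : nat} (H : 'M[R]_n)
    (s y : 'cV[R]_n) :
  H^T = H -> dotv s y != 0 ->
  BFGS_update H s y = qn_family H s y (dotv s y)^-1 0.
Proof.
move=> Hsym c0; rewrite /BFGS_update /qn_family /= mulr0 scale0r subr0.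
have yH : y^T *m H = (H *m y)^T by rewrite trmx_mul Hsym.
rewrite [_ *m H]mulmxBl mul1mx -scalemxAl -(mulmxA s) yH.
rewrite mulmxBr mulmx1 -scalemxAr mulmxBl (mulmxA H) -scalemxAl -(mulmxA s).
rewrite (mulmxA _ y) mulmx_dotv (dotvC (H *m y)) mul_scalar_mx -scalemxAr.
move: (dotv s y) c0 => c c0; move: (dotv y _) => b; move: (H *m y) => v.
apply/matrixP => i j; rewrite !mxE !big_ord1 !mxE.
by field.
Qed.

Lemma cvg_qn_family {R : realType} {n : nat} (H : 'M[R]_n) (s y : 'cV[R]_n)
    {T : Type} {F : set_system T} {FF : Filter F} {t u : T -> R} {t0 u0 : R} :
  t x @[x --> F] --> t0 -> u x @[x --> F] --> u0 ->
  qn_family H s y (t x) (u x) @[x --> F] --> qn_family H s y t0 u0.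
Proof.
move=> tt0 uu0.
have t2 : t x ^+ 2 @[x --> F] --> t0 ^+ 2 by exact: cvgM.
apply: cvgB; [apply: cvgB; [apply: cvgD|]|].
- exact: cvg_cst.
- by apply: cvgZr_tmp; apply: cvgD => //; apply: cvgM => //; exact: cvg_cst.
- by apply: cvgZr_tmp; apply: cvgM => //; exact: cvg_cst.
- by apply: cvgZr_tmp; apply: cvgM.
Qed.

Lemma cvg_inv_pinfty {R : realType} : x^-1 @[x --> +oo] --> (0 : R).
Proof. by apply/gtr0_cvgV0; [exact: nbhs_pinfty_gt|exact: cvg_id]. Qed.

Lemma cvg_div_softQN_gamma {R : realType} {n : nat} (H : 'M[R]_n)
    (s y : 'cV[R]_n) :
  0 < dotv s y ->
  alpha / softQN_gamma H s y alpha @[alpha --> +oo] --> (dotv s y)^-1.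
Proof.
move=> c0; set b := dotv y (H *m y); set c := dotv s y.
(* Dividing numerator and denominator of [alpha / gamma] by [alpha] gives [f (1 / alpha)], so the
   limit at infinity becomes continuity of [f] at 0. *)
pose f (u : R) := (2^-1 * u + Num.sqrt (4^-1 * u ^+ 2 + b * u + c ^+ 2))^-1.
have f0 : f 0 = c^-1.
  by rewrite /f expr2 !mulr0 !add0r sqrtr_sqr gtr0_norm.
have cf : f x @[x --> (0 : R)] --> f 0.
  (* The denominator is nonzero at 0 because its inverse is [c^-1]. *)
  apply: cvgV; first by rewrite -invr_eq0 -/(f 0) f0 invr_eq0 gt_eqF.
  apply: cvgD; first by apply: cvgM; [exact: cvg_cst|exact: cvg_id].
  apply: continuous_cvg; first exact: sqrt_continuous.
  apply: cvgD; last exact: cvg_cst.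
  apply: cvgD; last by apply: cvgM; [exact: cvg_cst|exact: cvg_id].
  by apply: cvgM; [exact: cvg_cst|apply: cvgM; exact: cvg_id].
rewrite -f0; apply: cvg_trans (cvg_comp _ _ cvg_inv_pinfty cf).
apply: near_eq_cvg; near=> a => /=.
have a0 : 0 < a by near: a; exact: nbhs_pinfty_gt.
rewrite /f /softQN_gamma -/b -/c.
have -> : 4^-1 + a * b + a ^+ 2 * c ^+ 2 =
    a ^+ 2 * (4^-1 * a^-1 ^+ 2 + b * a^-1 + c ^+ 2).
  by field; rewrite gt_eqF.
rewrite sqrtrM ?sqr_ge0// sqrtr_sqr gtr0_norm//.
move: (Num.sqrt _) => r.
have -> : 2^-1 + a * r = (2^-1 * a^-1 + r) * a by field; rewrite gt_eqF.
by rewrite invfM mulrCA divff ?mulr1// gt_eqF.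
Unshelve. all: by end_near. Qed.

Theorem theorem3p2 (R : realType) (n : nat) (H : 'M[R]_n) (s y : 'cV[R]_n)
    (Hsym : H \is symmetricmx) (Hpos : posdefmx H) (sy_gt0 : 0 < dotv s y) :
  softQN_update H s y alpha @[alpha --> +oo] --> BFGS_update H s y.
Proof.
have HT : H^T = H.
  (* [symmetricmx] is the hermitian predicate with sign [(-1) ^+ 0] and the identity as
     conjugation. *)
  by move/is_hermitianmxP: Hsym => {2}->; rewrite expr0 scale1r map_mx_id.
rewrite BFGS_update_family ?gt_eqF//.
have tc := cvg_div_softQN_gamma H _ _ sy_gt0.
apply: cvg_trans (cvg_qn_family H s y tc cvg_inv_pinfty).
apply: near_eq_cvg; near=> a.
(* The identity requires [0 < a], which holds near [+oo]. *)
rewrite softQN_update_family ?posdefmx_ge0//.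
Unshelve. all: by end_near. Qed.
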